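(* Let $R$ be a regular Noetherian ring of characteristic $p>0$. Let $(M,\theta_M)$ and $(N,\theta_N)$ be $\mathscr{F}$-modules over $R$. Regard $M$ (resp. $N$) as a Frobenius module via the $R$-linear map $\varphi_M:M\to F_*M$, $\varphi_M(m)=\theta_M^{-1}(1\otimes m)$ (resp. $\varphi_N:N\to F_*N$, $\varphi_N(n)=\theta_N^{-1}(1\otimes n)$). Then $$\mathrm{Hom}_{R[F]}(M,N)=\mathrm{Hom}_{\mathscr{F}}(M,N)=\mathrm{Hom}_R(M,N)^{\varphi=1}$$ as $\mathbb{F}_p$-subspaces of $\mathrm{Hom}_R(M,N)$, where the Frobenius module structure $\varphi$ on $\mathrm{Hom}_R(M,N)$ is defined by $\varphi(f)=\theta_N^{-1}\circ(\mathrm{id}\otimes f)\circ\theta_M$ for $f\in\mathrm{Hom}_R(M,N)$.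
   Context: All rings are commutative with $1$. For a ring $A$ of characteristic $p>0$ and an $A$-module $N$, $F_*N$ is the abelian group $N$ with $A$-action $a\ast n=a^pn$, and $F^*N=F_*A\otimes_A N$ with $a(b\otimes n)=ab\otimes n$ and $a\otimes bn=ab^p\otimes n$; for an $A$-linear map $f$, $F^*f=\mathrm{id}\otimes f$. A Frobenius module over $A$ is a pair $(N,\varphi_N)$ with $N$ an $A$-module and $\varphi_N:N\to F_*N$ an $A$-linear map, i.e. an additive map $\varphi_N:N\to N$ with $\varphi_N(an)=a^p\varphi_N(n)$. A morphism of Frobenius modules $(M,\varphi_M)\to(N,\varphi_N)$ is an $A$-linear map $f$ with $\varphi_N\circ f=f\circ\varphi_M$; the $\mathbb{F}_p$-space of these is $\mathrm{Hom}_{A[F]}(M,N)$. The fixed part of $(N,\varphi_N)$ is the $\mathbb{F}_p$-subspace $N^{\varphi=1}=\{n\in N\mid\varphi_N(n)=n\}$. For $R$ regular Noetherian of characteristic $p>0$, an $\mathscr{F}$-module over $R$ is a pair $(M,\theta_M)$ with $M$ an $R$-module and $\theta_M:M\to F^*M$ an $R$-module isomorphism. A morphism of $\mathscr{F}$-modules $(M,\theta_M)\to(N,\theta_N)$ is an $R$-linear map $f$ with $\theta_N\circ f=F^*f\circ\theta_M$; the $\mathbb{F}_p$-space of these is $\mathrm{Hom}_{\mathscr{F}}(M,N)$. *)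

(* Defs.v *)
(* Classical logic from boolp is used throughout: `[< P >] is the boolean that
   decides the proposition P, so an arbitrary subset is a boolean predicate.
   Rings are comNzRingType because a ring of characteristic p > 0 is nonzero. *)
From HB Require Import structures.
From mathcomp Require Import all_boot all_algebra.
From mathcomp Require Import generic_quotient ring_quotient boolp ring.
From mathcomp.multinomials Require Import freeg.

Set Implicit Arguments.
Unset Strict Implicit.
Unset Printing Implicit Defensive.

Import GRing.Theory.
Local Open Scope ring_scope.
Local Open Scope quotient_scope.

Section GeneratedSubmodule.
Variables (R : comNzRingType) (V : lmodType R) (G : V -> Prop).

Definition submod_gen : {pred V} := fun x =>
  `[< forall S : submodClosed V, (forall g, G g -> g \in S) -> x \in S >].

Lemma submod_genP x :
  reflect (forall S : submodClosed V, (forall g, G g -> g \in S) -> x \in S)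
          (x \in submod_gen).
Proof. exact: asboolP. Qed.

Lemma submod_gen_closed : submod_closed submod_gen.
Proof.
split=> [|a u v /submod_genP hu /submod_genP hv]; apply/submod_genP=> S hS.
  exact: rpred0.
by rewrite rpredD ?rpredZ ?hu ?hv.
Qed.

HB.instance Definition _ :=
  GRing.isSubmodClosed.Build R V submod_gen submod_gen_closed.

End GeneratedSubmodule.

Section QuotientModule.
Variables (R : comNzRingType) (V : lmodType R) (W : submodClosed V).

Lemma submod_zmod_closed : zmod_closed W.
Proof.
by split=> [|x y xW yW]; rewrite ?rpred0 // -scaleN1r rpredD ?rpredZ.
Qed.

Definition submod_zmod : zmodClosed V :=
  let mixin := GRing.isZmodClosed.Build V (W : {pred V}) submod_zmod_closed in
  HB.pack_for (zmodClosed V) (W : {pred V}) mixin.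

Definition quot_mod : Type := Quotient.quot submod_zmod.

HB.instance Definition _ := GRing.Zmodule.on quot_mod.

Definition quot_pi (x : V) : quot_mod := \pi_(Quotient.quot submod_zmod)%type x.

Lemma quot_piP x y : (quot_pi x = quot_pi y) <-> (x - y \in W).
Proof.
rewrite -[x - y \in W]/(x - y \in submod_zmod) Quotient.idealrBE.
by split=> [h|/eqP //]; apply/eqP.
Qed.

Lemma quot_pi_surj (q : quot_mod) : {x : V | q = quot_pi x}.
Proof. by exists (repr (q : Quotient.quot submod_zmod)); rewrite /quot_pi reprK. Qed.

Lemma quot_piD x y : quot_pi (x + y) = quot_pi x + quot_pi y.
Proof. by rewrite /quot_pi raddfD. Qed.

Definition quot_scale (a : R) (q : quot_mod) : quot_mod :=
  quot_pi (a *: repr (q : Quotient.quot submod_zmod)).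

Lemma quot_piZ a x : quot_scale a (quot_pi x) = quot_pi (a *: x).
Proof.
apply/quot_piP; rewrite -scalerBr rpredZ //; apply/quot_piP.
by rewrite {1}/quot_pi reprK.
Qed.

Lemma quot_scaleA a b q : quot_scale a (quot_scale b q) = quot_scale (a * b) q.
Proof. by have [x ->] := quot_pi_surj q; rewrite !quot_piZ scalerA. Qed.

Lemma quot_scale1 : left_id 1 quot_scale.
Proof. by move=> q; have [x ->] := quot_pi_surj q; rewrite quot_piZ scale1r. Qed.

Lemma quot_scaleDr : right_distributive quot_scale +%R.
Proof.
move=> a q r; have [x ->] := quot_pi_surj q; have [y ->] := quot_pi_surj r.
by rewrite -quot_piD !quot_piZ scalerDr quot_piD.
Qed.

Lemma quot_scaleDl q : {morph quot_scale^~ q : a b / a + b}.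
Proof.
by move=> a b; have [x ->] := quot_pi_surj q; rewrite !quot_piZ scalerDl quot_piD.
Qed.

HB.instance Definition _ := GRing.Zmodule_isLmodule.Build R quot_mod
  quot_scaleA quot_scale1 quot_scaleDr quot_scaleDl.

Lemma quot_pi_linear : linear quot_pi.
Proof. by move=> a x y; rewrite quot_piD -quot_piZ. Qed.

HB.instance Definition _ :=
  GRing.isLinear.Build R V quot_mod _ quot_pi quot_pi_linear.

Section Lift.
Variables (U : lmodType R) (f : {linear V -> U}).
Hypothesis fW : forall x, x \in W -> f x = 0.

Definition quot_lift (q : quot_mod) : U := f (repr (q : Quotient.quot submod_zmod)).

Lemma quot_liftE x : quot_lift (quot_pi x) = f x.
Proof.
apply/eqP; rewrite -subr_eq0 -linearB; apply/eqP/fW/quot_piP.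
by rewrite {1}/quot_pi reprK.
Qed.

Lemma quot_lift_linear : linear quot_lift.
Proof.
move=> a q r; have [x ->] := quot_pi_surj q; have [y ->] := quot_pi_surj r.
by rewrite -linearP !quot_liftE linearP.
Qed.

End Lift.
End QuotientModule.

Section FreeModule.
Variables (R : comNzRingType) (K : choiceType) (V : lmodType R) (f : K -> V).

Lemma fglift_linear : linear (fglift f : {freeg K / R} -> V).
Proof.
have fB := lift_is_additive f.
have fD (x y : {freeg K / R}) : fglift f (x + y) = fglift f x + fglift f y.
  have f0 : fglift f (0 : {freeg K / R}) = 0 by rewrite -(subrr 0) fB subrr.
  have fN z : fglift f (- z : {freeg K / R}) = - fglift f z.
    by rewrite -sub0r fB f0 sub0r.
  by rewrite -[y in LHS]opprK fB fN opprK.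
have fS (s : seq K) (F : K -> {freeg K / R}) :
    fglift f (\sum_(z <- s) F z) = \sum_(z <- s) fglift f (F z).
  elim: s => [|z s IH]; last by rewrite !big_cons fD IH.
  by rewrite !big_nil -(subrr 0) fB subrr.
move=> a x y; rewrite fD; congr (_ + _).
rewrite -{2}[x]freeg_sumE fS scaler_sumr [a *: x]/(fgscale a x) /fgscale fS.
by apply: eq_bigr => z _; rewrite !liftU scalerA.
Qed.

HB.instance Definition _ := GRing.isLinear.Build R {freeg K / R} V _
  (fglift f : {freeg K / R} -> V) fglift_linear.

End FreeModule.

Section Tensor.
Variables (R : comNzRingType) (M N : lmodType R).

Local Notation free := {freeg (M * N)%type / R}.
Local Notation gen m n := (<< (m, n) >> : free).

Inductive tensor_relator : free -> Prop :=
| TensorDl m m' n : tensor_relator (gen (m + m') n - gen m n - gen m' n)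
| TensorDr m n n' : tensor_relator (gen m (n + n') - gen m n - gen m n')
| TensorZl a m n : tensor_relator (gen (a *: m) n - a *: gen m n)
| TensorZr a m n : tensor_relator (gen m (a *: n) - a *: gen m n).

(* M ⊗_R N : the free R-module on M * N modulo the bilinearity relations *)
Definition tensor : Type := quot_mod (submod_gen tensor_relator).

HB.instance Definition _ := GRing.Lmodule.on tensor.

Definition tens (m : M) (n : N) : tensor :=
  quot_pi (submod_gen tensor_relator) (gen m n).

Lemma tensor_relator0 x :
  tensor_relator x -> quot_pi (submod_gen tensor_relator) x = 0.
Proof.
move=> rx; rewrite -(linear0 (quot_pi _)); apply/quot_piP; rewrite subr0.
by apply/submod_genP=> S; apply.
Qed.

Lemma tensDl m m' n : tens (m + m') n = tens m n + tens m' n.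
Proof.
apply/eqP; rewrite -subr_eq0 opprD addrA; apply/eqP.
by have := tensor_relator0 (TensorDl m m' n); rewrite !linearB.
Qed.

Lemma tensDr m n n' : tens m (n + n') = tens m n + tens m n'.
Proof.
apply/eqP; rewrite -subr_eq0 opprD addrA; apply/eqP.
by have := tensor_relator0 (TensorDr m n n'); rewrite !linearB.
Qed.

Lemma tensZl a m n : tens (a *: m) n = a *: tens m n.
Proof.
apply/eqP; rewrite -subr_eq0; apply/eqP.
by have := tensor_relator0 (TensorZl a m n); rewrite linearB linearZ.
Qed.

Lemma tensZr a m n : tens m (a *: n) = a *: tens m n.
Proof.
apply/eqP; rewrite -subr_eq0; apply/eqP.
by have := tensor_relator0 (TensorZr a m n); rewrite linearB linearZ.
Qed.

Lemma tensor_sum (t : tensor) :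
  exists s : seq (M * N), t = \sum_(x <- s) tens x.1 x.2.
Proof.
have [x ->] := quot_pi_surj t; rewrite -[x]freeg_sumE linear_sum.
exists [seq (coeff z x *: z.1, z.2) | z <- dom x]; rewrite [RHS]big_map.
apply: eq_bigr => -[m n] _ /=; rewrite tensZl /tens -linearZ; congr quot_pi.
by apply/eqP/freeg_eqP=> z; rewrite coeff_fgscale !coeffU mul1r.
Qed.

Lemma tensor_eq (V : zmodType) (f g : {additive tensor -> V}) :
  (forall m n, f (tens m n) = g (tens m n)) -> f =1 g.
Proof.
move=> fg t; have [s ->] := tensor_sum t.
by rewrite !raddf_sum; apply: eq_bigr => z _.
Qed.

End Tensor.

Section TensorMap.
Variables (R : comNzRingType) (M N M' N' : lmodType R).
Variables (f : {linear M -> M'}) (g : {linear N -> N'}).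

Definition tensor_pre (x : M * N) : tensor M' N' := tens (f x.1) (g x.2).

Definition tensor_map : tensor M N -> tensor M' N' :=
  quot_lift (W := submod_gen (@tensor_relator R M N)) (fglift tensor_pre).

Lemma tensor_pre0 x : x \in submod_gen (@tensor_relator R M N) ->
  fglift tensor_pre x = 0.
Proof.
pose kerp : {pred {freeg (M * N)%type / R}} := fun x => fglift tensor_pre x == 0.
have kerP : submod_closed kerp.
  split=> [|a u v]; first by rewrite /in_mem /= /kerp linear0.
  by rewrite /in_mem /= /kerp => /eqP hu /eqP hv; rewrite fglift_linear hu hv scaler0 addr0.
pose K := HB.pack_for (submodClosed {freeg (M * N)%type / R}) kerp
  (GRing.isSubmodClosed.Build _ _ kerp kerP).
move=> /submod_genP/(_ K) hx; apply/eqP; apply: hx => y; rewrite /in_mem /= /kerp.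
have E z : fglift tensor_pre (<< z >> : {freeg (M * N)%type / R}) = tensor_pre z.
  by rewrite liftU scale1r.
case=> [m m' n|m n n'|a m n|a m n]; rewrite !linearB ?linearZ /= !E /tensor_pre /=.
- by rewrite linearD tensDl [_ + _ - _]addrAC addrK subrr.
- by rewrite linearD tensDr [_ + _ - _]addrAC addrK subrr.
- by rewrite linearZ /= tensZl scalerN subrr.
- by rewrite linearZ /= tensZr scalerN subrr.
Qed.

Lemma tensor_mapE m n : tensor_map (tens m n) = tens (f m) (g n).
Proof. by rewrite /tensor_map (quot_liftE tensor_pre0) /= liftU scale1r. Qed.

Lemma tensor_map_linear : linear tensor_map.
Proof. exact: quot_lift_linear tensor_pre0. Qed.

HB.instance Definition _ :=
  GRing.isLinear.Build R (tensor M N) (tensor M' N') _ tensor_map tensor_map_linear.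

End TensorMap.

Section Localization.
Variables (R : comNzRingType) (P : prime_idealr R).

Record loc_frac := LocFrac { loc_val : R * R; _ : loc_val.2 \notin P }.

HB.instance Definition _ := [isSub for loc_val].
HB.instance Definition _ := [Choice of loc_frac by <:].

Local Notation num x := (loc_val x).1.
Local Notation den x := (loc_val x).2.

Lemma loc_denP (x : loc_frac) : den x \notin P. Proof. by case: x. Qed.

Lemma notin_primeM u v : u \notin P -> v \notin P -> u * v \notin P.
Proof. by move=> hu hv; rewrite prime_idealrM negb_or hu. Qed.

Lemma notin_prime1 : 1 \notin P. Proof. by rewrite idealr1. Qed.

Definition loc_equiv (x y : loc_frac) : bool :=
  `[< exists2 u, u \notin P & u * (num x * den y - num y * den x) = 0 >].

Lemma loc_equiv_refl : reflexive loc_equiv.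
Proof.
by move=> x; apply/asboolP; exists 1; rewrite ?notin_prime1 // subrr mulr0.
Qed.

Lemma loc_equiv_sym : symmetric loc_equiv.
Proof.
by move=> x y; apply/asboolP/asboolP=> -[u hu e]; exists u => //;
  rewrite -opprB mulrN e oppr0.
Qed.

Lemma loc_equiv_trans : transitive loc_equiv.
Proof.
move=> y x z /asboolP[u hu exy] /asboolP[v hv eyz]; apply/asboolP.
exists (u * v * den y); first by rewrite !notin_primeM ?loc_denP.
transitivity (v * den z * (u * (num x * den y - num y * den x))
  + u * den x * (v * (num y * den z - num z * den y))); first by ring.
by rewrite exy eyz !mulr0 addr0.
Qed.

Canonical loc_equiv_equiv :=
  EquivRel loc_equiv loc_equiv_refl loc_equiv_sym loc_equiv_trans.

Definition loc := {eq_quot loc_equiv}.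

HB.instance Definition _ : EqQuotient _ loc_equiv loc := EqQuotient.on loc.
HB.instance Definition _ := Choice.on loc.

Definition loc_pi (x : loc_frac) : loc := \pi_loc x.

Lemma loc_piP x y : loc_pi x = loc_pi y <->
  exists2 u, u \notin P & u * (num x * den y - num y * den x) = 0.
Proof.
split=> [/eqP|h]; first by rewrite eqmodE => /asboolP.
by apply/eqP; rewrite eqmodE; apply/asboolP.
Qed.

Lemma loc_piK x : loc_pi (repr x) = x. Proof. exact: reprK. Qed.

Definition frac_add (x y : loc_frac) : loc_frac :=
  @LocFrac (num x * den y + num y * den x, den x * den y)
    (notin_primeM (loc_denP x) (loc_denP y)).
Definition frac_opp (x : loc_frac) : loc_frac :=
  @LocFrac (- num x, den x) (loc_denP x).
Definition frac_mul (x y : loc_frac) : loc_frac :=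
  @LocFrac (num x * num y, den x * den y)
    (notin_primeM (loc_denP x) (loc_denP y)).
Definition frac_of (a : R) : loc_frac := @LocFrac (a, 1) notin_prime1.

Definition loc_add (x y : loc) : loc := loc_pi (frac_add (repr x) (repr y)).
Definition loc_opp (x : loc) : loc := loc_pi (frac_opp (repr x)).
Definition loc_mul (x y : loc) : loc := loc_pi (frac_mul (repr x) (repr y)).
Definition loc_of (a : R) : loc := loc_pi (frac_of a).

Lemma loc_addE x y : loc_add (loc_pi x) (loc_pi y) = loc_pi (frac_add x y).
Proof.
have /loc_piP[u hu eu] := loc_piK (loc_pi x).
have /loc_piP[v hv ev] := loc_piK (loc_pi y).
apply/loc_piP; exists (u * v); rewrite ?notin_primeM //=.
set x' := repr _ in eu *; set y' := repr _ in ev *.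
transitivity (v * den y' * den y * (u * (num x' * den x - num x * den x'))
  + u * den x' * den x * (v * (num y' * den y - num y * den y'))); first by ring.
by rewrite eu ev !mulr0 addr0.
Qed.

Lemma loc_oppE x : loc_opp (loc_pi x) = loc_pi (frac_opp x).
Proof.
have /loc_piP[u hu eu] := loc_piK (loc_pi x).
apply/loc_piP; exists u => //=; set x' := repr _ in eu *.
by transitivity (- (u * (num x' * den x - num x * den x'))); [ring | rewrite eu oppr0].
Qed.

Lemma loc_mulE x y : loc_mul (loc_pi x) (loc_pi y) = loc_pi (frac_mul x y).
Proof.
have /loc_piP[u hu eu] := loc_piK (loc_pi x).
have /loc_piP[v hv ev] := loc_piK (loc_pi y).
apply/loc_piP; exists (u * v); rewrite ?notin_primeM //=.
set x' := repr _ in eu *; set y' := repr _ in ev *.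
transitivity (v * num y' * den y * (u * (num x' * den x - num x * den x'))
  + u * num x * den x' * (v * (num y' * den y - num y * den y'))); first by ring.
by rewrite eu ev !mulr0 addr0.
Qed.

Lemma loc_eq x y :
  num x * den y = num y * den x -> loc_pi x = loc_pi y.
Proof.
by move=> e; apply/loc_piP; exists 1; rewrite ?notin_prime1 // e subrr mulr0.
Qed.

Lemma loc_addA : associative loc_add.
Proof.
move=> x y z; rewrite -[x]loc_piK -[y]loc_piK -[z]loc_piK !loc_addE.
by apply: loc_eq => /=; ring.
Qed.

Lemma loc_addC : commutative loc_add.
Proof.
move=> x y; rewrite -[x]loc_piK -[y]loc_piK !loc_addE.
by apply: loc_eq => /=; ring.
Qed.

Lemma loc_add0 : left_id (loc_of 0) loc_add.
Proof.
by move=> x; rewrite -[x]loc_piK loc_addE; apply: loc_eq => /=; ring.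
Qed.

Lemma loc_addN : left_inverse (loc_of 0) loc_opp loc_add.
Proof.
by move=> x; rewrite -[x]loc_piK loc_oppE loc_addE; apply: loc_eq => /=; ring.
Qed.

HB.instance Definition _ :=
  GRing.isZmodule.Build loc loc_addA loc_addC loc_add0 loc_addN.

Lemma loc_mulA : associative loc_mul.
Proof.
move=> x y z; rewrite -[x]loc_piK -[y]loc_piK -[z]loc_piK !loc_mulE.
by apply: loc_eq => /=; ring.
Qed.

Lemma loc_mulC : commutative loc_mul.
Proof.
move=> x y; rewrite -[x]loc_piK -[y]loc_piK !loc_mulE.
by apply: loc_eq => /=; ring.
Qed.

Lemma loc_mul1 : left_id (loc_of 1) loc_mul.
Proof.
by move=> x; rewrite -[x]loc_piK loc_mulE; apply: loc_eq => /=; ring.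
Qed.

Lemma loc_mulDl : left_distributive loc_mul +%R.
Proof.
move=> x y z; rewrite -[x]loc_piK -[y]loc_piK -[z]loc_piK.
rewrite -[LHS]/(loc_mul (loc_add _ _) _) -[RHS]/(loc_add _ _).
by rewrite !(loc_addE, loc_mulE); apply: loc_eq => /=; ring.
Qed.

Lemma loc_one_neq0 : loc_of 1 != 0.
Proof.
apply/eqP=> /loc_piP[u hu] /=.
by rewrite !mulr1 subr0 mulr1 => u0; rewrite u0 idealr0 in hu.
Qed.

HB.instance Definition _ := GRing.Zmodule_isComNzRing.Build loc
  loc_mulA loc_mulC loc_mul1 loc_mulDl loc_one_neq0.

End Localization.

(* An ideal of A is a submodule of the regular module A^o; MathComp's [idealr]
   and [prime_idealr] are the proper ideals and the prime ideals. *)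
Definition ideal_gen (A : comNzRingType) (s : seq A) : {pred A} :=
  submod_gen (V := A^o) (fun x => x \in s).

Definition noetherian (A : comNzRingType) : Prop :=
  forall I : submodClosed A^o, exists s : seq A, (I : {pred A}) =i ideal_gen s.

Definition maximal_ideal (A : comNzRingType) (m : idealr A) : Prop :=
  forall J : idealr A, {subset m <= J} -> {subset J <= m}.

Definition prime_chain (A : comNzRingType) (n : nat) : Prop :=
  exists Q : 'I_n.+1 -> prime_idealr A, forall i j : 'I_n.+1, (i < j)%N ->
    {subset Q i <= Q j} /\ ~ {subset Q j <= Q i}.

Definition krull_dim (A : comNzRingType) (d : nat) : Prop :=
  prime_chain A d /\ forall n, prime_chain A n -> (n <= d)%N.

(* Noetherian local, with maximal ideal generated by dim A elements *)
Definition regular_local (A : comNzRingType) : Prop :=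
  noetherian A /\
  exists m : idealr A,
    (forall J : idealr A, maximal_ideal J <-> J =i m) /\
    exists d : nat, krull_dim A d /\ exists s : d.-tuple A, m =i ideal_gen s.

Definition regular_noetherian (A : comNzRingType) : Prop :=
  noetherian A /\ forall P : prime_idealr A, regular_local (loc P).

Section Frobenius.
Variables (R : comNzRingType) (p : nat) (charRp : p \in [pchar R]).

Lemma Frob_is_additive (a b : R) : (a + b) ^+ p = a ^+ p + b ^+ p.
Proof. by rewrite -!(pFrobenius_autE charRp) rmorphD. Qed.

(* F_* N; the characteristic makes the action a * n = a ^ p n additive in a *)
Definition Fpush (_ : p \in [pchar R]) (N : lmodType R) : Type := N.

(* N with the scalar action of F_p through F_p -> R *)
Definition Fp_space (_ : p \in [pchar R]) (N : lmodType R) : Type := N.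

Section Push.
Variable N : lmodType R.

Local Notation FN := (Fpush charRp N).

HB.instance Definition _ := GRing.Zmodule.on FN.

Definition Fpush_scale (a : R) (n : FN) : FN := a ^+ p *: (n : N).

Lemma Fpush_scaleA a b n : Fpush_scale a (Fpush_scale b n) = Fpush_scale (a * b) n.
Proof. by rewrite /Fpush_scale scalerA exprMn. Qed.

Lemma Fpush_scale1 : left_id 1 Fpush_scale.
Proof. by move=> n; rewrite /Fpush_scale expr1n scale1r. Qed.

Lemma Fpush_scaleDr : right_distributive Fpush_scale +%R.
Proof. by move=> a m n; rewrite /Fpush_scale -scalerDr. Qed.

Lemma Fpush_scaleDl n : {morph Fpush_scale^~ n : a b / a + b}.
Proof. by move=> a b; rewrite /Fpush_scale Frob_is_additive scalerDl. Qed.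

HB.instance Definition _ := GRing.Zmodule_isLmodule.Build R FN
  Fpush_scaleA Fpush_scale1 Fpush_scaleDr Fpush_scaleDl.

Lemma FpushZ a (n : FN) : a *: n = a ^+ p *: (n : N) :> N.
Proof. by []. Qed.

Local Notation VN := (Fp_space charRp N).

HB.instance Definition _ := GRing.Zmodule.on VN.

Definition Fp_scale (k : 'F_p) (n : VN) : VN := (k : nat)%:R *: (n : N).

Lemma natr_Fp k : ((inZp k : 'F_p) : nat)%:R = k%:R :> R.
Proof.
have /Fp_cast e := pcharf_prime charRp.
by rewrite [in RHS](divn_eq k p) natrD mulrnA (mulrn_pchar charRp) add0r /= e.
Qed.

Lemma Fp_scaleA a b n : Fp_scale a (Fp_scale b n) = Fp_scale (a * b) n.
Proof. by rewrite /Fp_scale scalerA natr_Fp natrM. Qed.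

Lemma Fp_scale1 : left_id 1 Fp_scale.
Proof. by move=> n; rewrite /Fp_scale scale1r. Qed.

Lemma Fp_scaleDr : right_distributive Fp_scale +%R.
Proof. by move=> a m n; rewrite /Fp_scale -scalerDr. Qed.

Lemma Fp_scaleDl n : {morph Fp_scale^~ n : a b / a + b}.
Proof. by move=> a b; rewrite /Fp_scale natr_Fp natrD scalerDl. Qed.

HB.instance Definition _ := GRing.Zmodule_isLmodule.Build 'F_p VN
  Fp_scaleA Fp_scale1 Fp_scaleDr Fp_scaleDl.

End Push.

Lemma Fp_submod (N : lmodType R) (S : {pred Fp_space charRp N}) :
  zmod_closed S -> submod_closed S.
Proof.
move=> [S0 SB]; split=> // a u v uS vS.
have SN w : w \in S -> - w \in S by move=> wS; rewrite -sub0r SB.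
have SD w w' : w \in S -> w' \in S -> w + w' \in S.
  by move=> wS w'S; rewrite -[w']opprK SB ?SN.
apply: (SD) => //; rewrite -[a *: u]/((a : nat)%:R *: (u : N)) scaler_nat.
by elim: (a : nat) => [|n IH]; rewrite ?mulr0n // mulrS SD.
Qed.

End Frobenius.

Section HomModule.
Variables (R : comNzRingType) (M N : lmodType R).
Implicit Types f g h : {linear M -> N}.

HB.instance Definition _ := gen_eqMixin {linear M -> N}.
HB.instance Definition _ := gen_choiceMixin {linear M -> N}.

Lemma linear_ext f g : f =1 g -> f = g.
Proof.
case: f g => [f cf] [g cg] /= /funext efg; case: _ / efg cg => cg.
congr GRing.Linear.Pack; case: cf cg => [[a] [b]] [[a'] [b']].
by rewrite (Prop_irrelevance a a') (Prop_irrelevance b b').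
Qed.

Definition hom_zero : {linear M -> N} := \0.
Definition hom_add f g : {linear M -> N} := f \+ g.
Definition hom_opp f : {linear M -> N} := \- f.
Definition hom_scale (a : R) f : {linear M -> N} := a \*: f.

Lemma hom_addA : associative hom_add.
Proof. by move=> f g h; apply: linear_ext => x /=; rewrite addrA. Qed.

Lemma hom_addC : commutative hom_add.
Proof. by move=> f g; apply: linear_ext => x /=; rewrite addrC. Qed.

Lemma hom_add0 : left_id hom_zero hom_add.
Proof. by move=> f; apply: linear_ext => x /=; rewrite add0r. Qed.

Lemma hom_addN : left_inverse hom_zero hom_opp hom_add.
Proof. by move=> f; apply: linear_ext => x /=; rewrite addNr. Qed.

HB.instance Definition _ :=
  GRing.isZmodule.Build {linear M -> N} hom_addA hom_addC hom_add0 hom_addN.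

Lemma hom_scaleA a b f : hom_scale a (hom_scale b f) = hom_scale (a * b) f.
Proof. by apply: linear_ext => x /=; rewrite scalerA. Qed.

Lemma hom_scale1 : left_id 1 hom_scale.
Proof. by move=> f; apply: linear_ext => x /=; rewrite scale1r. Qed.

Lemma hom_scaleDr : right_distributive hom_scale +%R.
Proof. by move=> a f g; apply: linear_ext => x /=; rewrite scalerDr. Qed.

Lemma hom_scaleDl f : {morph hom_scale^~ f : a b / a + b}.
Proof. by move=> a b; apply: linear_ext => x /=; rewrite scalerDl. Qed.

HB.instance Definition _ := GRing.Zmodule_isLmodule.Build R {linear M -> N}
  hom_scaleA hom_scale1 hom_scaleDr hom_scaleDl.

Lemma homDE f g x : (f + g) x = f x + g x. Proof. by []. Qed.
Lemma homNE f x : (- f) x = - f x. Proof. by []. Qed.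
Lemma homZE a f x : (a *: f) x = a *: f x. Proof. by []. Qed.

End HomModule.

Section Pullback.
Variables (R : comNzRingType) (p : nat) (charRp : p \in [pchar R]).

Local Notation FR := (Fpush charRp R^o).

(* multiplication by a on the factor F_* R, which is R-linear for the action
   r * b = r ^ p b *)
Definition Fmul (a : R) (b : FR) : FR := a * (b : R).

Lemma Fmul_linear a : linear (Fmul a).
Proof.
by move=> r b c; rewrite /Fmul !FpushZ /= mulrDr; congr (_ + _); rewrite mulrCA.
Qed.

HB.instance Definition _ a := GRing.isLinear.Build R FR FR _ (Fmul a) (Fmul_linear a).

Section Object.
Variable N : lmodType R.

(* F^* N = F_* R ⊗_R N, on which R acts through multiplication on the factor
   F_* R and not through the action that defines the tensor product *)
Definition Fpull : Type := tensor FR N.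
Local Notation FN := Fpull.

HB.instance Definition _ := GRing.Zmodule.on FN.

Definition Fpure (b : R) (n : N) : FN := tens (b : FR) n.

Definition Fpull_scale (a : R) (t : FN) : FN :=
  tensor_map (Fmul a) (@idfun N) (t : tensor FR N).

Lemma Fpull_scaleE a b n : Fpull_scale a (Fpure b n) = Fpure (a * b) n.
Proof. exact: tensor_mapE. Qed.

Lemma Fpure_balanced a b n : Fpure b (a *: n) = Fpure (a ^+ p * b) n.
Proof. by rewrite /Fpure tensZr -tensZl. Qed.

Lemma FpureDl b b' n : Fpure (b + b') n = Fpure b n + Fpure b' n.
Proof. exact: tensDl. Qed.

Lemma FpureDr b n n' : Fpure b (n + n') = Fpure b n + Fpure b n'.
Proof. exact: tensDr. Qed.

Lemma Fpure_sum (t : FN) : exists s : seq (R * N), t = \sum_(x <- s) Fpure x.1 x.2.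
Proof. by have [s e] := tensor_sum (t : tensor FR N); exists s. Qed.

Lemma Fpull_scaleDr : right_distributive Fpull_scale +%R.
Proof. by move=> a s t; rewrite /Fpull_scale raddfD. Qed.

Lemma Fpull_scale_sum a (s : seq (R * N)) :
  Fpull_scale a (\sum_(x <- s) Fpure x.1 x.2) = \sum_(x <- s) Fpure (a * x.1) x.2.
Proof.
rewrite /Fpull_scale raddf_sum; apply: eq_bigr => x _; exact: Fpull_scaleE.
Qed.

Lemma Fpull_scaleA a b t : Fpull_scale a (Fpull_scale b t) = Fpull_scale (a * b) t.
Proof.
have [s ->] := Fpure_sum t; rewrite !Fpull_scale_sum /Fpull_scale raddf_sum.
by apply: eq_bigr => x _; rewrite -mulrA; exact: Fpull_scaleE.
Qed.

Lemma Fpull_scale1 : left_id 1 Fpull_scale.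
Proof.
move=> t; have [s ->] := Fpure_sum t; rewrite Fpull_scale_sum.
by apply: eq_bigr => x _; rewrite mul1r.
Qed.

Lemma Fpull_scaleDl t : {morph Fpull_scale^~ t : a b / a + b}.
Proof.
move=> a b; have [s ->] := Fpure_sum t; rewrite !Fpull_scale_sum -big_split.
by apply: eq_bigr => x _; rewrite mulrDl FpureDl.
Qed.

HB.instance Definition _ := GRing.Zmodule_isLmodule.Build R FN
  Fpull_scaleA Fpull_scale1 Fpull_scaleDr Fpull_scaleDl.

Lemma FpullZ a b n : a *: Fpure b n = Fpure (a * b) n.
Proof. exact: Fpull_scaleE. Qed.

End Object.

Section Map.
Variables (M N : lmodType R) (f : {linear M -> N}).

Definition Fpull_map (t : Fpull M) : Fpull N :=
  tensor_map (@idfun FR) f t.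

Lemma Fpull_mapE b m : Fpull_map (Fpure b m) = Fpure b (f m).
Proof. exact: tensor_mapE. Qed.

Lemma Fpull_mapD : {morph Fpull_map : s t / s + t}.
Proof. by move=> s t; rewrite /Fpull_map raddfD. Qed.

Lemma Fpull_map_sum (s : seq (R * M)) :
  Fpull_map (\sum_(x <- s) Fpure x.1 x.2) = \sum_(x <- s) Fpure x.1 (f x.2).
Proof.
rewrite /Fpull_map raddf_sum; apply: eq_bigr => x _; exact: Fpull_mapE.
Qed.

Lemma Fpull_map_linear : linear Fpull_map.
Proof.
move=> a t u; rewrite Fpull_mapD; congr (_ + _); have [s ->] := Fpure_sum t.
rewrite scaler_sumr Fpull_map_sum scaler_sumr.
under eq_bigr do rewrite FpullZ.
under [RHS]eq_bigr do rewrite FpullZ.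
rewrite -(big_map (fun x : R * M => (a * x.1, x.2)) xpredT (fun x => Fpure x.1 x.2)).
by rewrite Fpull_map_sum big_map.
Qed.

HB.instance Definition _ := GRing.isLinear.Build R (Fpull M)
  (Fpull N) _ Fpull_map Fpull_map_linear.

End Map.

Lemma Fpull_map_comb (M N : lmodType R) (a : R) (f g : {linear M -> N}) t :
  Fpull_map (a *: f + g) t = a ^+ p *: Fpull_map f t + Fpull_map g t.
Proof.
have [s ->] := Fpure_sum t; rewrite !Fpull_map_sum scaler_sumr -big_split /=.
by apply: eq_bigr => x _; rewrite ?homDE ?homZE FpureDr Fpure_balanced FpullZ.
Qed.

End Pullback.

Section Modules.
Variables (R : comNzRingType) (p : nat) (charRp : p \in [pchar R]).

Record frob_module := FrobModule {
  frob_carrier :> lmodType R;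
  frob_map : {linear frob_carrier -> Fpush charRp frob_carrier}
}.

Section FixedPart.
Variable N : frob_module.

Definition fixed_pred : {pred Fp_space charRp N} := fun n =>
  `[< frob_map N n = n :> N >].

Lemma fixed_pred_closed : submod_closed fixed_pred.
Proof.
apply: Fp_submod; split=> [|u v /asboolP hu /asboolP hv]; apply/asboolP.
  exact: raddf0.
rewrite [LHS](raddfB (frob_map N) (u : N) v).
exact: (congr2 (fun x y : N => x - y) hu hv).
Qed.

HB.instance Definition _ := GRing.isSubmodClosed.Build 'F_p
  (Fp_space charRp N) fixed_pred fixed_pred_closed.

Definition fixed_part : submodClosed (Fp_space charRp N) := fixed_pred.

End FixedPart.

Section FrobHom.
Variables M N : frob_module.

Definition HomRF_pred : {pred Fp_space charRp {linear M -> N}} := fun f =>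
  `[< forall m : M, frob_map N ((f : {linear M -> N}) m) =
        (f : {linear M -> N}) (frob_map M m) :> N >].

Lemma HomRF_closed : submod_closed HomRF_pred.
Proof.
apply: Fp_submod; split=> [|f g /asboolP hf /asboolP hg]; apply/asboolP => m.
  exact: raddf0.
rewrite [LHS](raddfB (frob_map N) ((f : {linear M -> N}) m)
                                  ((g : {linear M -> N}) m)).
transitivity ((f : {linear M -> N}) (frob_map M m)
  - (g : {linear M -> N}) (frob_map M m)); last by [].
exact: (congr2 (fun x y : N => x - y) (hf m) (hg m)).
Qed.

HB.instance Definition _ := GRing.isSubmodClosed.Build 'F_p
  (Fp_space charRp {linear M -> N}) HomRF_pred HomRF_closed.

Definition HomRF : submodClosed (Fp_space charRp {linear M -> N}) := HomRF_pred.

End FrobHom.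

(* θ is an isomorphism: its (unique) inverse θ^-1 is part of the record *)
Record F_module := FModule {
  F_carrier :> lmodType R;
  theta : {linear F_carrier -> Fpull charRp F_carrier};
  theta_inv : {linear Fpull charRp F_carrier -> F_carrier};
  thetaK : cancel theta theta_inv;
  theta_invK : cancel theta_inv theta
}.

Section FHom.
Variables M N : F_module.

Definition HomF_pred : {pred Fp_space charRp {linear M -> N}} := fun f =>
  `[< theta N \o (f : {linear M -> N}) =1
      Fpull_map (f : {linear M -> N}) \o theta M >].

Lemma HomF_closed : submod_closed HomF_pred.
Proof.
apply: Fp_submod; split=> [|f g /asboolP hf /asboolP hg]; apply/asboolP => m /=.
  rewrite [LHS](raddf0 (theta N)); have [s ->] := Fpure_sum (theta M m).
  rewrite Fpull_map_sum big1 // => x _; apply: (addrI (Fpure charRp x.1 0)).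
  by rewrite -FpureDr !addr0.
rewrite [LHS](raddfB (theta N) ((f : {linear M -> N}) m)
                               ((g : {linear M -> N}) m)).
move: (hf m) (hg m) => /= -> ->; have [s ->] := Fpure_sum (theta M m).
rewrite !Fpull_map_sum -sumrB; apply: eq_bigr => x _.
apply/eqP; rewrite subr_eq -FpureDr; apply/eqP; congr (Fpure _ _ _).
exact: esym (subrK _ _).
Qed.

HB.instance Definition _ := GRing.isSubmodClosed.Build 'F_p
  (Fp_space charRp {linear M -> N}) HomF_pred HomF_closed.

Definition HomF : submodClosed (Fp_space charRp {linear M -> N}) := HomF_pred.

End FHom.

(* φ(m) = θ^-1 (1 ⊗ m) *)
Section Underlying.
Variable M : F_module.

Definition F_phi (m : M) : Fpush charRp M := theta_inv M (Fpure charRp 1 m).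

Lemma F_phi_linear : linear F_phi.
Proof.
move=> a m m'; rewrite FpushZ /F_phi FpureDr linearD Fpure_balanced -FpullZ.
by rewrite linearZ.
Qed.

HB.instance Definition _ :=
  GRing.isLinear.Build R M (Fpush charRp M) _ F_phi F_phi_linear.

Definition frob_of_F : frob_module := @FrobModule M F_phi.

End Underlying.

(* φ(f) = θ_N^-1 ∘ (id ⊗ f) ∘ θ_M on the R-module Hom_R(M, N) *)
Section HomFrob.
Variables M N : F_module.

Definition hom_phi (f : {linear M -> N}) : Fpush charRp {linear M -> N} :=
  theta_inv N \o Fpull_map f \o theta M : {linear M -> N}.

Lemma hom_phi_linear : linear hom_phi.
Proof.
move=> a f g; apply: linear_ext => m.
by rewrite [LHS]/= Fpull_map_comb [LHS]linearP.
Qed.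

HB.instance Definition _ := GRing.isLinear.Build R {linear M -> N}
  (Fpush charRp {linear M -> N}) _ hom_phi hom_phi_linear.

Definition Hom_frob : frob_module := @FrobModule {linear M -> N} hom_phi.

End HomFrob.

End Modules.

(* Main.v *)
Require Import Defs.
From mathcomp Require Import all_boot all_algebra boolp.

(** Each of the three conditions on an [R]-linear map [f] says that the square
    formed by [theta M], [theta N], [f] and its Frobenius pullback commutes;
    they differ in which sides of the square are inverted and on which elements
    it is tested.  Membership in [HomF] is the square itself; inverting
    [theta N] turns it into the equation [hom_phi f = f].  Inverting both
    structure maps turns it into an equality of two [R]-linear maps out of the
    pullback of [M], and that module is generated over [R] by the tensors
    [1 (x) m] (lemma [Fpull_linear_eq]).  On these generators the equality is
    precisely the compatibility of [f] with the Frobenius structures, which is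
    membership in [HomRF]. *)

Set Implicit Arguments.
Unset Strict Implicit.
Unset Printing Implicit Defensive.

Import GRing.Theory.
Local Open Scope ring_scope.

(** Scalars act on the factor [F_* R], so [b (x) n = b *: (1 (x) n)], and the
    tensors [1 (x) n] generate the pullback as an [R]-module. *)
Lemma Fpull_linear_eq (R : comNzRingType) (p : nat) (charRp : p \in [pchar R])
    (N V : lmodType R) (g h : {linear Fpull charRp N -> V}) :
  (forall n, g (Fpure charRp 1 n) = h (Fpure charRp 1 n)) -> g =1 h.
Proof.
move=> gh t; have [s ->] := Fpure_sum t.
rewrite !linear_sum; apply: eq_bigr => -[b n] _ /=.
by rewrite -[b]mulr1 -FpullZ !linearZ /= gh.
Qed.

Section FModuleMorphisms.
Variables (R : comNzRingType) (p : nat) (charRp : p \in [pchar R]).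
Variables (M N : F_module charRp) (f : {linear M -> N}).

(** With both structure maps inverted the condition compares two linear maps
    out of the pullback, so it can be tested on the generators [1 (x) m]. *)
Lemma HomF_invP :
  f \in HomF M N <-> f \o theta_inv M =1 theta_inv N \o Fpull_map f.
Proof.
split=> [/asboolP fF t | fF]; last apply/asboolP => m /=.
  by have /= := fF (theta_inv M t); rewrite theta_invK => <-; rewrite thetaK.
by have /= := fF (theta M m); rewrite thetaK => ->; rewrite theta_invK.
Qed.

Lemma HomRF_HomF : f \in HomRF (frob_of_F M) (frob_of_F N) <-> f \in HomF M N.
Proof.
rewrite HomF_invP; split=> [/asboolP fRF | fF].
  apply: Fpull_linear_eq => m /=.
  by rewrite Fpull_mapE; exact/esym/fRF.
apply/asboolP => m; have /= := fF (Fpure charRp 1 m).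
by rewrite Fpull_mapE => e; exact/esym/e.
Qed.

Lemma HomF_fixed : f \in HomF M N <-> f \in fixed_part (Hom_frob M N).
Proof.
split=> [/asboolP fF | /asboolP ffix]; apply/asboolP.
  by apply: linear_ext => m /=; rewrite -[Fpull_map _ _]fF /= thetaK.
move=> m; have /(congr1 (fun g : {linear M -> N} => g m)) /= e := ffix.
by rewrite /= -[in LHS]e theta_invK.
Qed.

End FModuleMorphisms.

Theorem proposition2p12 (R : comNzRingType) (p : nat) (charRp : p \in [pchar R])
    (regR : regular_noetherian R) (M N : F_module charRp) :
  HomRF (frob_of_F M) (frob_of_F N) =i HomF M N /\
  HomF M N =i fixed_part (Hom_frob M N).
Proof.
by split=> f; apply/idP/idP => fH; first [exact/HomRF_HomF | exact/HomF_fixed].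
Qed.
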